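(* Let $D_n=\sum_{k\ge0}\binom{n}{k}\binom{n+k}{k}$ be the central Delannoy numbers and $A_n=\sum_{k\ge0}\binom{n}{k}^2\binom{n+k}{k}$ the Apéry numbers. For $n\in\mathbb{N}$, $$D_n\equiv A_n\equiv\begin{cases}1\pmod 3&\text{if } n\in T(02),\\ 0\pmod 3&\text{otherwise.}\end{cases}$$
   Context: $T(02)$ denotes the set of $n\in\mathbb{N}$ whose base-$3$ expansion contains only the digits $0$ and $2$. *)

(* Defs.v *)
From mathcomp Require Import all_boot.

Set Implicit Arguments.
Unset Strict Implicit.
Unset Printing Implicit Defensive.

(* The coefficient of b ^ i in the base-b expansion of n; it is 0 for every
   position i beyond the leading digit. *)
Definition digit (b n i : nat) : nat := (n %/ b ^ i) %% b.

(* The quantifier also ranges over the positions beyond the leading digit,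
   which is harmless since the digit 0 is allowed; in particular T02 0 holds. *)
Definition T02 (n : nat) : Prop := forall i : nat, digit 3 n i \in [:: 0; 2].

(* The sums over all k >= 0 stop at k = n because 'C(n, k) = 0 for k > n. *)
Definition delannoy (n : nat) : nat := \sum_(k < n.+1) 'C(n, k) * 'C(n + k, k).

Definition apery (n : nat) : nat :=
  \sum_(k < n.+1) 'C(n, k) ^ 2 * 'C(n + k, k).

(* Main.v *)
Require Import Defs.
From mathcomp Require Import all_boot.

(** Both numbers are values, at [e = 1] and [e = 2], of the sum of
['C(n, k) ^ e * 'C(n + k, k)] over [k].  By Lucas' theorem each summand is
multiplicative modulo [p] along the last base-[p] digits of [n] and [k], hence
so is the sum: modulo 3 it is the product of its values at the digits of [n],
which are 1, 0 and 1 at the digits 0, 1 and 2. *)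

(** This is [(1 + X) ^ p = 1 + X ^ p] modulo [p], read on coefficients: in Vandermonde's sum, [p]
    divides ['C(p, j)] for [0 < j < p]. *)
Lemma bin_addp_mod (p n k : nat) : prime p ->
  'C(p + n, k) = 'C(n, k) + (if p <= k then 'C(n, k - p) else 0) %[mod p].
Proof.
move=> p_pr; rewrite -Vandermonde big_ord_recl bin0 mul1n subn0.
rewrite -modnDmr -[in RHS]modnDmr; congr ((_ + _) %% p).
have p_gt0 := prime_gt0 p_pr.
have [le_pk | lt_kp] := leqP p k; last first.
  apply/eqP; rewrite mod0n; apply/dvdn_sum => j _; apply/dvdn_mulr.
  by apply: prime_dvd_bin => //; rewrite lift0 /= (leq_ltn_trans _ lt_kp).
have lt_pk : p.-1 < k by rewrite prednK.
(* The term [j = p] has index [p.-1], since the term [j = 0] has been split off. *)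
rewrite (bigD1 (Ordinal lt_pk)) //= /bump /= add1n prednK // binn mul1n.
rewrite -[in RHS](addn0 'C(_, _)) -modnDmr -[in RHS]modnDmr.
congr ((_ + _) %% p); apply/eqP; rewrite mod0n.
apply/dvdn_sum => j neq_jp; apply/dvdn_mulr; rewrite add1n.
have [lt_jp | | eq_jp] := ltngtP j.+1 p; first by rewrite prime_dvd_bin.
  by move=> lt_pj; rewrite bin_small.
by case/eqP: neq_jp; apply/val_inj; rewrite /= -eq_jp.
Qed.

(** Induction on [m]: adding [p] to the upper argument turns [bin_addp_mod] into Pascal's rule for
    ['C(m.+1, l.+1)]. *)
Lemma lucas (p m l r s : nat) : prime p -> r < p -> s < p ->
  'C(m * p + r, l * p + s) = 'C(m, l) * 'C(r, s) %[mod p].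
Proof.
move=> p_pr lt_rp lt_sp; elim: m l => [|m IHm] [|l].
- by rewrite !mul0n bin0 mul1n.
- by rewrite !mul0n bin_small // mulSn -addnA ltn_addr.
- rewrite mulSn -addnA bin_addp_mod // mul0n add0n leqNgt lt_sp addn0.
  by have := IHm 0; rewrite mul0n add0n !bin0.
rewrite mulSn -addnA bin_addp_mod // (mulSn l) -addnA leq_addr addKn.
by rewrite addnA -mulSn -modnDm !IHm modnDm -mulnDl -binS.
Qed.

Lemma lucas_add (p m l r s : nat) : prime p -> r < p -> s < p ->
  'C(m * p + r + (l * p + s), l * p + s) = 'C(m + l, l) * 'C(r + s, s) %[mod p].
Proof.
move=> p_pr lt_rp lt_sp; rewrite addnACA -mulnDl.
have [lt_rsp | le_prs] := ltnP (r + s) p; first exact: lucas.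
(* If adding the last digits carries, both sides vanish. *)
have lt_rss : r + s - p < s by rewrite ltn_subLR // ltn_add2r.
have eq_rs : r + s = 1 * p + (r + s - p) by rewrite mul1n subnKC.
have lt_tp := ltn_trans lt_rss lt_sp.
rewrite [in LHS]eq_rs addnA -mulnDl lucas // (bin_small lt_rss) muln0.
(* With [t = r + s - p < s], ['C(p + t, s)] is congruent to ['C(1, 0) * 'C(t, s) = 0]. *)
rewrite -modnMmr [in RHS]eq_rs; have := @lucas p 1 0 _ s p_pr lt_tp lt_sp.
by rewrite mul0n add0n => ->; rewrite (bin_small lt_rss) muln0 mod0n muln0 mod0n.
Qed.

Definition binomial_sum (e n : nat) : nat :=
  \sum_(k < n.+1) 'C(n, k) ^ e * 'C(n + k, k).

(** Positivity of [e] makes the added terms vanish; for [e = 0] they would contain [0 ^ 0 = 1]. *)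
Lemma binomial_sum_widen (e n N : nat) : 0 < e -> n < N ->
  binomial_sum e n = \sum_(k < N) 'C(n, k) ^ e * 'C(n + k, k).
Proof.
move=> e_gt0 lt_nN.
rewrite /binomial_sum (big_ord_widen _ (fun k => 'C(n, k) ^ e * 'C(n + k, k)) lt_nN).
rewrite big_mkcond; apply: eq_bigr => k _; case: ltnP => // lt_nk.
by rewrite bin_small // exp0n.
Qed.

Lemma binomial_sum_lucas (p e m r : nat) : prime p -> 0 < e -> r < p ->
  binomial_sum e (m * p + r) = binomial_sum e m * binomial_sum e r %[mod p].
Proof.
move=> p_pr e_gt0 lt_rp.
(* The range is completed to [m.+1] full blocks of length [p], so that [k = l * p + s] with [l] and
   [s] varying independently. *)
rewrite (@binomial_sum_widen e (m * p + r) (m.+1 * p)) //; last first.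
  by rewrite mulSn addnC ltn_add2r.
rewrite (@binomial_sum_widen e r p) // /binomial_sum.
rewrite -(big_mkord predT (fun k => 'C(m * p + r, k) ^ e * 'C(_ + k, k))).
rewrite big_nat_mul big_mkord big_distrl /= -modn_summ -[in RHS]modn_summ.
congr (_ %% p); apply: eq_bigr => l _.
rewrite -{1}[_ * p]add0n big_addn mulSn addnK big_mkord big_distrr /=.
rewrite -modn_summ -[in RHS]modn_summ; congr (_ %% p).
apply: eq_bigr => s _; rewrite [s + _]addnC mulnACA -expnMn.
rewrite -modnMm -[in RHS]modnMm lucas_add //.
by rewrite -modnXm lucas // modnXm.
Qed.

Lemma T02_divn (n : nat) : T02 n <-> n %% 3 != 1 /\ T02 (n %/ 3).
Proof.
have digit0 : digit 3 n 0 = n %% 3 by rewrite /digit divn1.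
have digitS i : digit 3 n i.+1 = digit 3 (n %/ 3) i.
  by rewrite /digit expnS divnMA.
have digitE : (n %% 3 \in [:: 0; 2]) = (n %% 3 != 1).
  by have := ltn_pmod n (isT : 0 < 3); case: (n %% 3) => [|[|[]]].
split=> [Tn | [n0 Tn] [|i]]; last by rewrite digitS.
  by rewrite -digitE -digit0; split=> // i; rewrite -digitS.
by rewrite digit0 digitE.
Qed.

(** [T02] quantifies over all positions; deciding it allows a constructive case split when the two
    sums are compared. *)
Lemma T02_dec (n : nat) : decidable (T02 n).
Proof.
elim/ltn_ind: n => n IHn; have [-> | n_gt0] := posnP n.
  by left=> i; rewrite /digit div0n.
have [n0 | n0] := boolP (n %% 3 != 1); last first.
  by right=> /T02_divn[]; rewrite (negPf n0).
have [Tn | nTn] := IHn _ (ltn_Pdiv (isT : 1 < 3) n_gt0).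
  by left; apply/T02_divn.
by right=> /T02_divn[].
Qed.

Lemma binomial_sum_digit3 (e r : nat) : 0 < e -> r < 3 ->
  binomial_sum e r = (r != 1) %[mod 3].
Proof.
case: e => // e _; case: r => [|[|[|]]] // _.
- by rewrite /binomial_sum big_ord1 !bin0 exp1n.
- by rewrite /binomial_sum !big_ord_recl big_ord0 /= !exp1n.
(* At the digit 2 the sum is [1 + 2 ^ e.+1 * 3 + 6]. *)
rewrite /binomial_sum !big_ord_recl big_ord0 /= !exp1n /bump /=.
by rewrite addn0 mul1n addnCA -modnDml modnMl.
Qed.

Lemma binomial_sum_mod3 (e n : nat) : 0 < e ->
  (T02 n -> binomial_sum e n = 1 %[mod 3]) /\
  (~ T02 n -> binomial_sum e n = 0 %[mod 3]).
Proof.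
move=> e_gt0; elim/ltn_ind: n => n IHn.
have [-> | n_gt0] := posnP n.
  rewrite (@binomial_sum_digit3 e 0) //; split=> // nT0; case: nT0 => i.
  by rewrite /digit div0n.
have [IH1 IH0] := IHn _ (ltn_Pdiv (isT : 1 < 3) n_gt0).
have lt_n3 : n %% 3 < 3 by rewrite ltn_pmod.
have -> : binomial_sum e n = binomial_sum e (n %/ 3) * (n %% 3 != 1) %[mod 3].
  rewrite {1}(divn_eq n 3) binomial_sum_lucas // -modnMmr.
  by rewrite binomial_sum_digit3 // modnMmr.
split=> [/T02_divn[-> /IH1 eq1] | nTn]; first by rewrite muln1.
have [n0 | _] := boolP (n %% 3 != 1); last by rewrite muln0.
by rewrite muln1; apply: IH0 => Tn; apply/nTn/T02_divn.
Qed.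

Theorem theorem5p8 (n : nat) :
  delannoy n = apery n %[mod 3] /\
  (T02 n -> apery n = 1 %[mod 3]) /\
  (~ T02 n -> apery n = 0 %[mod 3]).
Proof.
have [D1 D0] := @binomial_sum_mod3 1 n isT.
have [A1 A0] := @binomial_sum_mod3 2 n isT.
have eqD : delannoy n = binomial_sum 1 n by apply: eq_bigr => k _; rewrite expn1.
split; last by [].
rewrite eqD; have [Tn | nTn] := T02_dec n; first by rewrite D1 // -A1.
by rewrite D0 // -A0.
Qed.
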